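(* Let $\mathcal P$ be the PRO for monoids, so that objects of the 2-category $\mathrm{Rep}_{\mathcal C\mathbf{-act}^c}(\mathcal P)$ are $\mathcal C$-actegories equipped with a monad and a distributive law between the $\mathcal C$-action and the monad. Then $\mathrm{Rep}_{\mathcal C\mathbf{-act}^c}(\mathcal P)$ is isomorphic to the following 2-category: - the objects are triples $(\mathcal M,\mathbf T,U^{\mathbf T}:\mathcal M^{\mathbf T}\to\mathcal M)$ where $\mathbf T$ is a (usual) monad on a $\mathcal C$-actegory $\mathcal M$ and $\mathcal M^{\mathbf T}$ is the Eilenberg–Moore category of $\mathbf T$ equipped with a $\mathcal C$-action making the forgetful functor $U^{\mathbf T}$ a strict $\mathcal C$-equivariant functor; - the 1-cells from $(\mathcal M,\mathbf S,U^{\mathbf S})$ to $(\mathcal N,\mathbf T,U^{\mathbf T})$ are the colax $\mathcal C$-equivariant functors of Eilenberg–Moore categories commuting with the forgetful functors, i.e. pairs of colax $\mathcal C$-equivariant functors $(K,\zeta^K):\mathcal M\to\mathcal N$ and $(H,\zeta^H):\mathcal M^{\mathbf S}\to\mathcal N^{\mathbf T}$ with $U^{\mathbf T}H=KU^{\mathbf S}$ and $U^{\mathbf T}\zeta^H=\zeta^K U^{\mathbf S}$ (that is, $U^{\mathbf T}(\zeta^H_{C,X})=\zeta^K_{C,U^{\mathbf S}X}$); - the 2-cells are the natural transformations of colax $\mathcal C$-equivariant functors commuting with the forgetful functors, i.e. pairs of $\mathcal C$-equivariant natural transformations $\sigma:(K,\zeta^K)\Rightarrow(K',\zeta^{K'})$,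 $\theta:(H,\zeta^H)\Rightarrow(H',\zeta^{H'})$ with $U^{\mathbf T}\theta=\sigma U^{\mathbf S}$.
   Context: $\mathcal C$ is a fixed monoidal category with product $\otimes$, unit $\mathbf 1$, associativity isomorphisms $a_{X,Y,Z}:X\otimes(Y\otimes Z)\to(X\otimes Y)\otimes Z$ and unit isomorphisms $l_A:\mathbf 1\otimes A\to A$, $r_A:A\otimes\mathbf 1\to A$. A $\mathcal C$-actegory is a category $\mathcal N$ with a bifunctor $\lozenge:\mathcal C\times\mathcal N\to\mathcal N$ and natural isomorphisms $\Psi_{Q,Q',N}:(Q\otimes Q')\lozenge N\to Q\lozenge(Q'\lozenge N)$, $u_N:\mathbf 1\lozenge N\to N$ such that $\Psi_{Q,Q',Q''\lozenge N}\circ\Psi_{Q\otimes Q',Q'',N}\circ(a_{Q,Q',Q''}\lozenge N)=(Q\lozenge\Psi_{Q',Q'',N})\circ\Psi_{Q,Q'\otimes Q'',N}$, $u_{Q\lozenge N}\circ\Psi_{\mathbf 1,Q,N}=l_Q\lozenge N$, $(Q\lozenge u_N)\circ\Psi_{Q,\mathbf 1,N}=r_Q\lozenge N$. A colax $\mathcal C$-equivariant functor $(F,\zeta):\mathcal M\to\mathcal N$ is a functor $F$ with a binatural transformation $\zeta_{C,M}:F(C\lozenge M)\to C\lozenge F(M)$ with $u_{F(M)}\circ\zeta_{\mathbf 1,M}=F(u_M)$ and $\Psi_{A,B,F(M)}\circ\zeta_{A\otimes B,M}=(A\lozenge\zeta_{B,M})\circ\zeta_{A,B\lozenge M}\circ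 F(\Psi_{A,B,M})$; it is strict if all $\zeta_{C,M}$ are identities. Composition: $(F,\zeta^F)\circ(G,\zeta^G)=(FG,\zeta^{FG})$, $\zeta^{FG}_{C,M}=\zeta^F_{C,GM}\circ F(\zeta^G_{C,M})$. A natural transformation $\alpha:F\Rightarrow G$ is $\mathcal C$-equivariant $(F,\zeta^F)\Rightarrow(G,\zeta^G)$ if $(C\lozenge\alpha_M)\circ\zeta^F_{C,M}=\zeta^G_{C,M}\circ\alpha_{C\lozenge M}$ for all $C,M$. For the PRO $\mathcal P$ for monoids (whose strict representations in endofunctors are monads), $\mathrm{Rep}_{\mathcal C\mathbf{-act}^c}(\mathcal P)$ is the 2-category described as follows. Objects: triples $(\mathcal M,\mathbf S,l^S)$, where $\mathcal M$ is a $\mathcal C$-actegory, $\mathbf S=(S,\mu^S,\eta^S)$ a monad on $\mathcal M$, and $l^S_{C,M}:S(C\lozenge M)\to C\lozenge SM$ a binatural transformation such that $(S,l^S)$ is colax $\mathcal C$-equivariant, $l^S_{C,M}\circ\mu^S_{C\lozenge M}=(C\lozenge\mu^S_M)\circ l^S_{C,SM}\circ S(l^S_{C,M})$ and $l^S_{C,M}\circ\eta^S_{C\lozenge M}=C\lozenge\eta^S_M$. 1-cells from $(\mathcal M,\mathbf S,l^S)$ to $(\mathcal N,\mathbf T,l^T)$ (maps of pairs, written by the paper as $(K,\zeta^K,\alpha):(\mathbf T,l^T)\to(\mathbf S,l^S)$): colax $\mathcal C$-equivariant functors $(K,\zeta^K):\mathcal M\to\mathcal N$ with a natural transformation $\alpha:TK\Rightarrow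 KS$ such that $\alpha\circ\mu^TK=K\mu^S\circ\alpha S\circ T\alpha$, $\alpha\circ\eta^TK=K\eta^S$, and for all $C$, with $G^{\mathcal M}=C\lozenge^{\mathcal M}\_$ and $G^{\mathcal N}=C\lozenge^{\mathcal N}\_$, $G^{\mathcal N}\alpha\circ l^TK\circ T\zeta^K=\zeta^KS\circ Kl^S\circ\alpha G^{\mathcal M}$. Composition: $(L,\zeta^L,\beta)\circ(K,\zeta^K,\alpha)=(LK,\zeta^LK\circ L\zeta^K,L\alpha\circ\beta K)$. 2-cells $(K,\zeta^K,\alpha)\Rightarrow(L,\zeta^L,\beta)$: $\mathcal C$-equivariant natural transformations $\sigma:(K,\zeta^K)\Rightarrow(L,\zeta^L)$ with $\beta\circ T\sigma=\sigma S\circ\alpha$, with the usual compositions of natural transformations. The Eilenberg–Moore category $\mathcal M^{\mathbf T}$ has as objects the $\mathbf T$-modules $(M,\nu:TM\to M)$, with forgetful functor $U^{\mathbf T}(M,\nu)=M$. Compositions in the second 2-category are componentwise. *)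

(* Defs.v *)
From Stdlib Require Import ssreflect FunctionalExtensionality ProofIrrelevance.

Set Implicit Arguments.
Unset Strict Implicit.
Unset Printing Implicit Defensive.
Set Primitive Projections.
#[local] Obligation Tactic := try (by intros); simpl.

Declare Scope cat_scope.
Delimit Scope cat_scope with cat.
Local Open Scope cat_scope.

Reserved Notation "g ∘ f" (at level 40, left associativity).
Reserved Notation "f ≡ g" (at level 70, no associativity).
Reserved Notation "x ⊗ y" (at level 35, right associativity).
Reserved Notation "f ⊗₁ g" (at level 35, right associativity).
Reserved Notation "c ◇ m" (at level 35, right associativity).
Reserved Notation "f ◇₁ g" (at level 35, right associativity).

Record Category := {
  ob :> Type;
  hom : ob -> ob -> Type;
  idm : forall x, hom x x;
  comp : forall x y z, hom y z -> hom x y -> hom x z;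
  compA : forall x y z w (h : hom z w) (g : hom y z) (f : hom x y),
    comp h (comp g f) = comp (comp h g) f;
  comp1m : forall x y (f : hom x y), comp (idm y) f = f;
  compm1 : forall x y (f : hom x y), comp f (idm x) = f }.

Arguments hom {c} x y.
Arguments idm {c} x.
Arguments comp {c x y z} g f.
Notation "g ∘ f" := (comp g f) : cat_scope.

(* Strict equality (not isomorphism) of morphisms whose endpoints are equal, but
   not necessarily convertible. *)
Inductive mor_eq (C : Category) (x y : C) (f : hom x y) :
  forall x' y' : C, hom x' y' -> Prop :=
  mor_refl : mor_eq f f.
Notation "f ≡ g" := (mor_eq f g) : cat_scope.

Definition is_iso (C : Category) (x y : C) (f : hom x y) : Prop :=
  exists g : hom y x, g ∘ f = idm x /\ f ∘ g = idm y.

Record Functor (C D : Category) := {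
  fob :> C -> D;
  fmap : forall x y, hom x y -> hom (fob x) (fob y);
  fmap1 : forall x, fmap (idm x) = idm (fob x);
  fmapM : forall x y z (g : hom y z) (f : hom x y),
    fmap (g ∘ f) = fmap g ∘ fmap f }.
Arguments fmap {C D} F {x y} f : rename.

Program Definition fid (C : Category) : Functor C C :=
  {| fob x := x; fmap x y f := f |}.

Program Definition fcomp (C D E : Category) (G : Functor D E) (F : Functor C D) :
  Functor C E := {| fob x := G (F x); fmap x y f := fmap G (fmap F f) |}.
Next Obligation. by move=> *; rewrite !fmap1. Qed.
Next Obligation. by move=> *; rewrite !fmapM. Qed.

Record NatTrans (C D : Category) (F G : Functor C D) := {
  nt :> forall x, hom (F x) (G x);
  nt_nat : forall x y (f : hom x y), nt y ∘ fmap F f = fmap G f ∘ nt x }.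

Program Definition Prod (C D : Category) : Category :=
  {| ob := (C * D)%type;
     hom p q := (hom (fst p) (fst q) * hom (snd p) (snd q))%type;
     idm p := (idm (fst p), idm (snd p));
     comp p q r g f := (fst g ∘ fst f, snd g ∘ snd f) |}.
Next Obligation. by move=> *; rewrite !compA. Qed.
Next Obligation. by move=> C D p q [f g]; rewrite /= !comp1m. Qed.
Next Obligation. by move=> C D p q [f g]; rewrite /= !compm1. Qed.

Definition bimap (A B C : Category) (D : Functor (Prod A B) C)
    (a a' : A) (b b' : B) (f : hom a a') (g : hom b b') :
  hom (D (a, b)) (D (a', b')) :=
  @fmap _ _ D (a, b) (a', b') (f, g).

Program Definition fprod (A A' B B' : Category)
    (F : Functor A A') (G : Functor B B') : Functor (Prod A B) (Prod A' B') :=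
  {| fob p := (F (fst p), G (snd p));
     fmap p q f := (fmap F (fst f), fmap G (snd f)) |}.
Next Obligation. by move=> *; rewrite !fmap1. Qed.
Next Obligation. by move=> *; rewrite !fmapM. Qed.

Program Definition prod_assoc (A B C : Category) :
  Functor (Prod (Prod A B) C) (Prod A (Prod B C)) :=
  {| fob p := (fst (fst p), (snd (fst p), snd p));
     fmap p q f := (fst (fst f), (snd (fst f), snd f)) |}.

Program Definition insl (A B : Category) (a : A) : Functor B (Prod A B) :=
  {| fob b := (a, b); fmap b b' g := (idm a, g) |}.
Next Obligation. by move=> *; rewrite comp1m. Qed.

Program Definition insr (A B : Category) (b : B) : Functor A (Prod A B) :=
  {| fob a := (a, b); fmap a a' f := (f, idm b) |}.
Next Obligation. by move=> *; rewrite comp1m. Qed.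

Lemma mor_eq_eq (C : Category) (x y : C) (f g : hom x y) : f ≡ g -> f = g.
Proof.
have gen : forall x' y' (h : hom x' y'), f ≡ h ->
    forall (e : x = x') (e' : y = y'),
    eq_rect y (fun b => hom x' b)
      (eq_rect x (fun a => hom a y) f x' e) y' e' = h.
  move=> x' y' h [] e e'.
  by rewrite (proof_irrelevance _ e eq_refl) (proof_irrelevance _ e' eq_refl).
by move=> /gen /(_ eq_refl eq_refl).
Qed.

Lemma eq_mor_eq (C : Category) (x y : C) (f g : hom x y) : f = g -> f ≡ g.
Proof. by move=> ->. Qed.

Lemma mor_eq_sym (C : Category) (x y x' y' : C) (f : hom x y)
    (g : hom x' y') : f ≡ g -> g ≡ f.
Proof. by case. Qed.

Lemma mor_eq_trans (C : Category) (x y x' y' x'' y'' : C) (f : hom x y)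
    (g : hom x' y') (h : hom x'' y'') : f ≡ g -> g ≡ h -> f ≡ h.
Proof. by move=> E; case: E h. Qed.

Lemma mor_eq_tgt (C : Category) (x y x' y' : C) (f : hom x y)
    (g : hom x' y') : f ≡ g -> y = y'.
Proof. by case. Qed.

Lemma mor_eq_idm (C : Category) (x y : C) : x = y -> idm x ≡ idm y.
Proof. by move=> ->. Qed.

Lemma mor_eq_comp (C : Category) (x y z x' y' z' : C)
    (g : hom y z) (f : hom x y) (g' : hom y' z') (f' : hom x' y') :
  g ≡ g' -> f ≡ f' -> g ∘ f ≡ g' ∘ f'.
Proof.
move=> Eg Ef; move: Ef g g' Eg => [] g g' Eg.
have Ez : z = z' by case: Eg.
by subst z'; rewrite (mor_eq_eq Eg).
Qed.

Lemma mor_eq_fmap (C D : Category) (F : Functor C D) (x y x' y' : C)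
    (f : hom x y) (g : hom x' y') : f ≡ g -> fmap F f ≡ fmap F g.
Proof. by case. Qed.

Lemma mor_eq_functor (C D : Category) (F G : Functor C D) (x y : C)
    (f : hom x y) : F = G -> fmap F f ≡ fmap G f.
Proof. by move=> ->. Qed.

Lemma functor_eq_ob (C D : Category) (F G : Functor C D) (x : C) :
  F = G -> F x = G x.
Proof. by move=> ->. Qed.

Lemma functor_ext (C D : Category) (F G : Functor C D) :
  (forall x y (f : hom x y), fmap F f ≡ fmap G f) -> F = G.
Proof.
case: F G => [F Fm F1 FM] [G Gm G1 GM] /= H.
have E : F = G.
  apply: functional_extensionality => x.
  have := H _ _ (idm x); rewrite F1 G1.
  by move: (F x) (G x) => a b [].
subst G.
have E : Fm = Gm.
  apply: functional_extensionality_dep => x.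
  apply: functional_extensionality_dep => y.
  apply: functional_extensionality_dep => f.
  exact: mor_eq_eq.
subst Gm.
by rewrite (proof_irrelevance _ F1 G1) (proof_irrelevance _ FM GM).
Qed.

Lemma fcompA (A B C D : Category) (H : Functor C D) (G : Functor B C)
    (F : Functor A B) : fcomp (fcomp H G) F = fcomp H (fcomp G F).
Proof. exact: functor_ext. Qed.

Lemma nt_ext (C D : Category) (F G : Functor C D) (s t : NatTrans F G) :
  (forall x, s x = t x) -> s = t.
Proof.
case: s t => [s sn] [t tn] /= H.
have E : s = t by exact: functional_extensionality_dep.
by subst t; rewrite (proof_irrelevance _ sn tn).
Qed.

(* Strict 2-categories, as categories enriched in the category of categories:
   the laws are equalities of functors between hom-categories, so each of them
   covers both 1-cells and 2-cells. *)
Record TwoCategory := {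
  ob2 :> Type;
  hom2 : ob2 -> ob2 -> Category;
  id2 : forall X, hom2 X X;
  hcomp : forall X Y Z, Functor (Prod (hom2 Y Z) (hom2 X Y)) (hom2 X Z);
  hcompA : forall X Y Z W,
    fcomp (hcomp X Y W) (fprod (hcomp Y Z W) (fid (hom2 X Y))) =
    fcomp (fcomp (hcomp X Z W) (fprod (fid (hom2 Z W)) (hcomp X Y Z)))
          (prod_assoc _ _ _);
  hcomp1m : forall X Y, fcomp (hcomp X Y Y) (insl (hom2 X Y) (id2 Y)) = fid _;
  hcompm1 : forall X Y, fcomp (hcomp X X Y) (insr (hom2 X Y) (id2 X)) = fid _ }.
Arguments hom2 {t} X Y.
Arguments id2 {t} X.
Arguments hcomp {t} X Y Z.

Record TwoFunctor (A B : TwoCategory) := {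
  tf0 :> A -> B;
  tf1 : forall X Y, Functor (hom2 X Y) (hom2 (tf0 X) (tf0 Y));
  tf_id : forall X, tf1 X X (id2 X) = id2 (tf0 X);
  tf_comp : forall X Y Z,
    fcomp (tf1 X Z) (hcomp X Y Z) =
    fcomp (hcomp (tf0 X) (tf0 Y) (tf0 Z)) (fprod (tf1 Y Z) (tf1 X Y)) }.
Arguments tf1 {A B} t X Y.

Program Definition tfid (A : TwoCategory) : TwoFunctor A A :=
  {| tf0 X := X; tf1 X Y := fid (hom2 X Y) |}.
Next Obligation. by move=> A X Y Z; apply: functor_ext => -[? ?] [? ?] [? ?]. Qed.


Program Definition tfcomp (A B C : TwoCategory)
    (G : TwoFunctor B C) (F : TwoFunctor A B) : TwoFunctor A C :=
  {| tf0 X := G (F X); tf1 X Y := fcomp (tf1 G _ _) (tf1 F X Y) |}.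
Next Obligation. by move=> A B C G F X /=; rewrite !tf_id. Qed.
Next Obligation.
move=> A B C G F X Y Z.
rewrite fcompA tf_comp -fcompA tf_comp fcompA.
by congr (fcomp _ _); apply: functor_ext.
Qed.

Definition two_isomorphic (A B : TwoCategory) : Prop :=
  exists (F : TwoFunctor A B) (G : TwoFunctor B A),
    tfcomp G F = tfid A /\ tfcomp F G = tfid B.

Record MonoidalCategory := {
  mcat :> Category;
  tens : Functor (Prod mcat mcat) mcat;
  tunit : mcat;
  assoc : forall X Y Z : mcat,
    hom (tens (X, tens (Y, Z))) (tens (tens (X, Y), Z));
  lunit : forall X : mcat, hom (tens (tunit, X)) X;
  runit : forall X : mcat, hom (tens (X, tunit)) X;
  assoc_iso : forall X Y Z, is_iso (assoc X Y Z);
  lunit_iso : forall X, is_iso (lunit X);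
  runit_iso : forall X, is_iso (runit X);
  assoc_nat : forall (X X' Y Y' Z Z' : mcat)
      (f : hom X X') (g : hom Y Y') (h : hom Z Z'),
    assoc X' Y' Z' ∘ bimap tens f (bimap tens g h) =
    bimap tens (bimap tens f g) h ∘ assoc X Y Z;
  lunit_nat : forall (X X' : mcat) (f : hom X X'),
    lunit X' ∘ bimap tens (idm tunit) f = f ∘ lunit X;
  runit_nat : forall (X X' : mcat) (f : hom X X'),
    runit X' ∘ bimap tens f (idm tunit) = f ∘ runit X;
  pentagon : forall X Y Z W : mcat,
    assoc (tens (X, Y)) Z W ∘ assoc X Y (tens (Z, W)) =
    bimap tens (assoc X Y Z) (idm W) ∘ assoc X (tens (Y, Z)) W
      ∘ bimap tens (idm X) (assoc Y Z W);
  triangle : forall X Y : mcat,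
    bimap tens (runit X) (idm Y) ∘ assoc X tunit Y =
    bimap tens (idm X) (lunit Y) }.
Arguments tunit {m}.
Arguments assoc {m} X Y Z.
Arguments lunit {m} X.
Arguments runit {m} X.

Notation "x ⊗ y" := (fob (tens _) (x, y)) : cat_scope.
Notation "f ⊗₁ g" := (bimap (tens _) f g) : cat_scope.

Record Action (V : MonoidalCategory) (N : Category) := {
  act : Functor (Prod V N) N;
  actA : forall (Q Q' : V) (X : N),
    hom (act (Q ⊗ Q', X)) (act (Q, act (Q', X)));
  actU : forall X : N, hom (act (tunit, X)) X;
  actA_iso : forall Q Q' X, is_iso (actA Q Q' X);
  actU_iso : forall X, is_iso (actU X);
  actA_nat : forall (Q P Q' P' : V) (X Y : N)
      (f : hom Q P) (g : hom Q' P') (h : hom X Y),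
    actA P P' Y ∘ bimap act (f ⊗₁ g) h =
    bimap act f (bimap act g h) ∘ actA Q Q' X;
  actU_nat : forall (X Y : N) (h : hom X Y),
    actU Y ∘ bimap act (idm tunit) h = h ∘ actU X;
  act_pentagon : forall (Q Q' Q'' : V) (X : N),
    actA Q Q' (act (Q'', X)) ∘ actA (Q ⊗ Q') Q'' X
      ∘ bimap act (assoc Q Q' Q'') (idm X) =
    bimap act (idm Q) (actA Q' Q'' X) ∘ actA Q (Q' ⊗ Q'') X;
  act_lunit : forall (Q : V) (X : N),
    actU (act (Q, X)) ∘ actA tunit Q X = bimap act (lunit Q) (idm X);
  act_runit : forall (Q : V) (X : N),
    bimap act (idm Q) (actU X) ∘ actA Q tunit X =
    bimap act (runit Q) (idm X) }.
Arguments actA {V N} a Q Q' X : rename.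
Arguments actU {V N} a X : rename.

Record Actegory (V : MonoidalCategory) := {
  acat :> Category;
  aact : Action V acat }.

Definition aob (V : MonoidalCategory) (N : Actegory V) (c : V) (m : N) : N :=
  act (aact N) (c, m).
Notation "c ◇ m" := (aob c m) : cat_scope.

Definition amap (V : MonoidalCategory) (N : Actegory V) (c c' : V) (m m' : N)
    (f : hom c c') (g : hom m m') : hom (c ◇ m) (c' ◇ m') :=
  bimap (act (aact N)) f g.
Notation "f ◇₁ g" := (amap f g) : cat_scope.

Definition aassoc (V : MonoidalCategory) (N : Actegory V) (c d : V) (m : N) :
  hom ((c ⊗ d) ◇ m) (c ◇ (d ◇ m)) := actA (aact N) c d m.

Definition aunit (V : MonoidalCategory) (N : Actegory V) (m : N) :
  hom (tunit ◇ m) m := actU (aact N) m.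

Lemma amap1 (V : MonoidalCategory) (N : Actegory V) (c : V) (m : N) :
  idm c ◇₁ idm m = idm (c ◇ m).
Proof. exact: (fmap1 (act (aact N)) (c, m)). Qed.

Lemma amapM (V : MonoidalCategory) (N : Actegory V) (c c' c'' : V)
    (m m' m'' : N) (f' : hom c' c'') (f : hom c c')
    (g' : hom m' m'') (g : hom m m') :
  (f' ∘ f) ◇₁ (g' ∘ g) = (f' ◇₁ g') ∘ (f ◇₁ g).
Proof.
exact: (@fmapM _ _ (act (aact N)) (c, m) (c', m') (c'', m'') (f', g') (f, g)).
Qed.

Lemma amapMr (V : MonoidalCategory) (N : Actegory V) (c : V)
    (m m' m'' : N) (g' : hom m' m'') (g : hom m m') :
  idm c ◇₁ (g' ∘ g) = (idm c ◇₁ g') ∘ (idm c ◇₁ g).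
Proof. by rewrite -amapM comp1m. Qed.

Record Colax (V : MonoidalCategory) (M N : Actegory V) (F : Functor M N) := {
  zeta : forall (c : V) (m : M), hom (F (c ◇ m)) (c ◇ F m);
  zeta_nat : forall (c c' : V) (m m' : M) (f : hom c c') (g : hom m m'),
    zeta c' m' ∘ fmap F (f ◇₁ g) = (f ◇₁ fmap F g) ∘ zeta c m;
  zeta_unit : forall m : M, aunit (F m) ∘ zeta tunit m = fmap F (aunit m);
  zeta_assoc : forall (a b : V) (m : M),
    aassoc a b (F m) ∘ zeta (a ⊗ b) m =
    (idm a ◇₁ zeta b m) ∘ zeta a (b ◇ m) ∘ fmap F (aassoc a b m) }.
Arguments zeta {V M N F} z c m : rename.

Definition strict (V : MonoidalCategory) (M N : Actegory V) (F : Functor M N)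
    (Z : Colax F) : Prop :=
  forall (c : V) (m : M), zeta Z c m ≡ idm (F (c ◇ m)).

Record ColaxFunctor (V : MonoidalCategory) (M N : Actegory V) := {
  cfun :> Functor M N;
  cstr :> Colax cfun }.

Lemma colax_ext (V : MonoidalCategory) (M N : Actegory V)
    (F G : ColaxFunctor M N) :
  (forall x y (f : hom x y), fmap F f ≡ fmap G f) ->
  (forall c m, zeta F c m ≡ zeta G c m) -> F = G.
Proof.
case: F G => [F ZF] [G ZG] /= H.
have E : F = G by exact: functor_ext.
subst G; clear H; case: ZF ZG => [z zn zu za] [z' zn' zu' za'] /= H.
have E : z = z'.
  apply: functional_extensionality_dep => c.
  by apply: functional_extensionality_dep => m; apply: mor_eq_eq.
subst z'.
by rewrite (proof_irrelevance _ zn zn') (proof_irrelevance _ zu zu')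
  (proof_irrelevance _ za za').
Qed.

Program Definition colax_id (V : MonoidalCategory) (M : Actegory V) :
  ColaxFunctor M M :=
  {| cfun := fid M; cstr := {| zeta c m := idm (c ◇ m) |} |}.
Next Obligation. by move=> *; rewrite comp1m compm1. Qed.
Next Obligation. by move=> *; rewrite compm1. Qed.
Next Obligation. by move=> *; rewrite /= amap1 compm1 !comp1m. Qed.

Program Definition colax_comp (V : MonoidalCategory) (M N P : Actegory V)
    (F : ColaxFunctor N P) (G : ColaxFunctor M N) : ColaxFunctor M P :=
  {| cfun := fcomp F G;
     cstr := {| zeta c m := zeta F c (G m) ∘ fmap F (zeta G c m) |} |}.
Next Obligation.
move=> V M N P F G c c' m m' f g /=.
by rewrite -compA -fmapM zeta_nat fmapM compA zeta_nat compA.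
Qed.
Next Obligation.
move=> V M N P F G m /=.
by rewrite compA zeta_unit -fmapM zeta_unit.
Qed.
Next Obligation.
move=> V M N P F G a b m /=.
rewrite compA zeta_assoc -!compA -fmapM zeta_assoc !fmapM amapMr -!compA.
by rewrite (compA _ (fmap F (idm a ◇₁ _))) zeta_nat -!compA.
Qed.

Record EqNat (V : MonoidalCategory) (M N : Actegory V)
    (F G : ColaxFunctor M N) := {
  enat :> NatTrans F G;
  enat_eq : forall (c : V) (m : M),
    (idm c ◇₁ enat m) ∘ zeta F c m = zeta G c m ∘ enat (c ◇ m) }.

Lemma eqnat_ext (V : MonoidalCategory) (M N : Actegory V)
    (F G : ColaxFunctor M N) (s t : EqNat F G) :
  (forall m, s m = t m) -> s = t.
Proof.
case: s t => [s sn] [t tn] /= H.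
have E : s = t by exact: nt_ext.
by subst t; rewrite (proof_irrelevance _ sn tn).
Qed.

Program Definition eqnat_id (V : MonoidalCategory) (M N : Actegory V)
    (F : ColaxFunctor M N) : EqNat F F :=
  {| enat := {| nt m := idm (F m) |} |}.
Next Obligation. by move=> *; rewrite comp1m compm1. Qed.
Next Obligation. by move=> *; rewrite /= amap1 comp1m compm1. Qed.

Program Definition eqnat_vcomp (V : MonoidalCategory) (M N : Actegory V)
    (F G H : ColaxFunctor M N) (t : EqNat G H) (s : EqNat F G) : EqNat F H :=
  {| enat := {| nt m := t m ∘ s m |} |}.
Next Obligation. by move=> *; rewrite -compA nt_nat compA nt_nat compA. Qed.
Next Obligation.
by move=> *; rewrite /= amapMr -compA enat_eq compA enat_eq compA.
Qed.

Program Definition eqnat_hcomp (V : MonoidalCategory) (M N P : Actegory V)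
    (K K' : ColaxFunctor M N) (L L' : ColaxFunctor N P)
    (t : EqNat L L') (s : EqNat K K') :
  EqNat (colax_comp L K) (colax_comp L' K') :=
  {| enat := {| nt m := t (K' m) ∘ fmap L (s m) |} |}.
Next Obligation.
move=> V M N P K K' L L' t s x y f /=.
by rewrite -compA -fmapM (nt_nat s) fmapM compA (nt_nat t) compA.
Qed.
Next Obligation.
move=> V M N P K K' L L' t s c m /=.
rewrite amapMr -compA (compA _ (zeta L _ _)) -zeta_nat -compA -fmapM enat_eq.
by rewrite fmapM !compA enat_eq -!compA (compA (fmap L' _)) -nt_nat -!compA.
Qed.

Lemma colax_compA (V : MonoidalCategory) (M N P Q : Actegory V)
    (H : ColaxFunctor P Q) (G : ColaxFunctor N P) (F : ColaxFunctor M N) :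
  colax_comp (colax_comp H G) F = colax_comp H (colax_comp G F).
Proof.
by apply: colax_ext => // c m; apply: eq_mor_eq; rewrite /= fmapM compA.
Qed.

Lemma colax_comp1m (V : MonoidalCategory) (M N : Actegory V)
    (F : ColaxFunctor M N) : colax_comp (colax_id N) F = F.
Proof.
by apply: colax_ext => // c m; apply: eq_mor_eq; rewrite /= comp1m.
Qed.

Lemma colax_compm1 (V : MonoidalCategory) (M N : Actegory V)
    (F : ColaxFunctor M N) : colax_comp F (colax_id M) = F.
Proof.
by apply: colax_ext => // c m; apply: eq_mor_eq; rewrite /= fmap1 compm1.
Qed.

Lemma eqnat_hcomp1 (V : MonoidalCategory) (M N P : Actegory V)
    (L : ColaxFunctor N P) (K : ColaxFunctor M N) (m : M) :
  eqnat_hcomp (eqnat_id L) (eqnat_id K) m = eqnat_id (colax_comp L K) m.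
Proof. by rewrite /= fmap1 comp1m. Qed.

Lemma eqnat_hcompM (V : MonoidalCategory) (M N P : Actegory V)
    (L L' L'' : ColaxFunctor N P) (K K' K'' : ColaxFunctor M N)
    (t' : EqNat L' L'') (t : EqNat L L')
    (s' : EqNat K' K'') (s : EqNat K K') (m : M) :
  eqnat_hcomp (eqnat_vcomp t' t) (eqnat_vcomp s' s) m =
  eqnat_vcomp (eqnat_hcomp t' s') (eqnat_hcomp t s) m.
Proof. by rewrite /= fmapM -!compA (compA (t _)) (nt_nat t) -!compA. Qed.

Lemma eqnat_hcompA (V : MonoidalCategory) (M N P Q : Actegory V)
    (H H' : ColaxFunctor P Q) (G G' : ColaxFunctor N P)
    (F F' : ColaxFunctor M N)
    (u : EqNat H H') (t : EqNat G G') (s : EqNat F F') (m : M) :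
  eqnat_hcomp (eqnat_hcomp u t) s m = eqnat_hcomp u (eqnat_hcomp t s) m.
Proof. by rewrite /= fmapM compA. Qed.

Lemma eqnat_hcomp1m (V : MonoidalCategory) (M N : Actegory V)
    (F F' : ColaxFunctor M N) (s : EqNat F F') (m : M) :
  eqnat_hcomp (eqnat_id (colax_id N)) s m = s m.
Proof. by rewrite /= comp1m. Qed.

Lemma eqnat_hcompm1 (V : MonoidalCategory) (M N : Actegory V)
    (F F' : ColaxFunctor M N) (s : EqNat F F') (m : M) :
  eqnat_hcomp s (eqnat_id (colax_id M)) m = s m.
Proof. by rewrite /= fmap1 compm1. Qed.

Record Monad (M : Category) := {
  mfun :> Functor M M;
  mu : NatTrans (fcomp mfun mfun) mfun;
  eta : NatTrans (fid M) mfun;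
  mu_assoc : forall x : M, mu x ∘ fmap mfun (mu x) = mu x ∘ mu (mfun x);
  mu_unitl : forall x : M, mu x ∘ eta (mfun x) = idm (mfun x);
  mu_unitr : forall x : M, mu x ∘ fmap mfun (eta x) = idm (mfun x) }.
Arguments mu {M} m.
Arguments eta {M} m.

Record Module (M : Category) (T : Monad M) := {
  carrier :> M;
  maction : hom (T carrier) carrier;
  maction_mu : maction ∘ fmap T maction = maction ∘ mu T carrier;
  maction_eta : maction ∘ eta T carrier = idm carrier }.
Arguments maction {M T} m.

Record ModuleMap (M : Category) (T : Monad M) (X Y : Module T) := {
  mmap :> hom (carrier X) (carrier Y);
  mmapP : mmap ∘ maction X = maction Y ∘ fmap T mmap }.

Lemma modulemap_ext (M : Category) (T : Monad M) (X Y : Module T)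
    (f g : ModuleMap X Y) : mmap f = mmap g -> f = g.
Proof.
case: f g => [f fP] [g gP] /= E.
by subst g; rewrite (proof_irrelevance _ fP gP).
Qed.

Program Definition EM (M : Category) (T : Monad M) : Category :=
  {| ob := Module T;
     hom X Y := ModuleMap X Y;
     idm X := {| mmap := idm (carrier X) |};
     comp X Y Z g f := {| mmap := mmap g ∘ mmap f |} |}.
Next Obligation. by move=> *; rewrite fmap1 comp1m compm1. Qed.
Next Obligation. by move=> *; rewrite -compA mmapP compA mmapP fmapM compA. Qed.
Next Obligation. by move=> *; apply: modulemap_ext; rewrite /= compA. Qed.
Next Obligation. by move=> *; apply: modulemap_ext; rewrite /= comp1m. Qed.
Next Obligation. by move=> *; apply: modulemap_ext; rewrite /= compm1. Qed.

Definition forgetful (M : Category) (T : Monad M) : Functor (EM T) M :=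
  @Build_Functor (EM T) M (@carrier M T) (@mmap M T)
    (fun _ => eq_refl) (fun _ _ _ _ _ => eq_refl).

(* The 2-category of representations of the PRO for monoids in C-actegories and
   colax equivariant functors, spelled out: 0-cells Rep0, 1-cells Rep1, 2-cells
   Rep2. The law of a 0-cell is S(c ◇ m) -> c ◇ S m, and [rlaw : Colax rmon]
   says that it makes S a colax equivariant endofunctor. *)
Record Rep0 (V : MonoidalCategory) := {
  rcat :> Actegory V;
  rmon : Monad rcat;
  rlaw : Colax rmon;
  rlaw_mu : forall (c : V) (m : rcat),
    zeta rlaw c m ∘ mu rmon (c ◇ m) =
    (idm c ◇₁ mu rmon m) ∘ zeta rlaw c (rmon m) ∘ fmap rmon (zeta rlaw c m);
  rlaw_eta : forall (c : V) (m : rcat),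
    zeta rlaw c m ∘ eta rmon (c ◇ m) = idm c ◇₁ eta rmon m }.
Arguments rmon {V} r.
Arguments rlaw {V} r.

Record Rep1 (V : MonoidalCategory) (X Y : Rep0 V) := {
  rfun :> ColaxFunctor X Y;
  ralpha : NatTrans (fcomp (rmon Y) rfun) (fcomp rfun (rmon X));
  ralpha_mu : forall m : X,
    ralpha m ∘ mu (rmon Y) (rfun m) =
    fmap rfun (mu (rmon X) m) ∘ ralpha (rmon X m) ∘ fmap (rmon Y) (ralpha m);
  ralpha_eta : forall m : X,
    ralpha m ∘ eta (rmon Y) (rfun m) = fmap rfun (eta (rmon X) m);
  ralpha_law : forall (c : V) (m : X),
    (idm c ◇₁ ralpha m) ∘ zeta (rlaw Y) c (rfun m)
      ∘ fmap (rmon Y) (zeta rfun c m) =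
    zeta rfun c (rmon X m) ∘ fmap rfun (zeta (rlaw X) c m)
      ∘ ralpha (c ◇ m) }.
Arguments ralpha {V X Y} r.

Lemma rep1_ext (V : MonoidalCategory) (X Y : Rep0 V) (K L : Rep1 X Y) :
  (forall x y (f : hom x y), fmap K f ≡ fmap L f) ->
  (forall c m, zeta K c m ≡ zeta L c m) ->
  (forall m, ralpha K m ≡ ralpha L m) -> K = L.
Proof.
case: K L => [K a am ae al] [L b bm be bl] /= H1 H2.
have E : K = L by exact: colax_ext.
subst L => H3.
have E : a = b by apply: nt_ext => m; exact: mor_eq_eq (H3 m).
subst b.
by rewrite (proof_irrelevance _ am bm) (proof_irrelevance _ ae be)
  (proof_irrelevance _ al bl).
Qed.

Record Rep2 (V : MonoidalCategory) (X Y : Rep0 V) (K L : Rep1 X Y) := {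
  rnat :> EqNat K L;
  rnatP : forall m : X,
    ralpha L m ∘ fmap (rmon Y) (rnat m) = rnat (rmon X m) ∘ ralpha K m }.

Lemma rep2_ext (V : MonoidalCategory) (X Y : Rep0 V) (K L : Rep1 X Y)
    (s t : Rep2 K L) : (forall m, s m = t m) -> s = t.
Proof.
case: s t => [s sP] [t tP] /= H.
have E : s = t by exact: eqnat_ext.
by subst t; rewrite (proof_irrelevance _ sP tP).
Qed.

Program Definition RepHom (V : MonoidalCategory) (X Y : Rep0 V) : Category :=
  {| ob := Rep1 X Y;
     hom K L := Rep2 K L;
     idm K := {| rnat := eqnat_id K |};
     comp K L P t s := {| rnat := eqnat_vcomp t s |} |}.
Next Obligation. by move=> *; rewrite /= fmap1 comp1m compm1. Qed.
Next Obligation.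
by move=> V X Y K L P t s m; rewrite /= fmapM compA (rnatP t) -!compA (rnatP s).
Qed.
Next Obligation. by move=> *; apply: rep2_ext => m; rewrite /= compA. Qed.
Next Obligation. by move=> *; apply: rep2_ext => m; rewrite /= comp1m. Qed.
Next Obligation. by move=> *; apply: rep2_ext => m; rewrite /= compm1. Qed.

Lemma rep2_mor_eq (V : MonoidalCategory) (X Y : Rep0 V)
    (K L K' L' : RepHom X Y) (s : hom K L) (t : hom K' L') :
  K = K' -> L = L' ->
  (forall m, nt (enat (rnat s)) m ≡ nt (enat (rnat t)) m) -> s ≡ t.
Proof.
move=> EK EL; subst K' L' => H.
by apply: eq_mor_eq; apply: rep2_ext => m; apply: mor_eq_eq.
Qed.

Program Definition rep_id (V : MonoidalCategory) (X : Rep0 V) : Rep1 X X :=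
  {| rfun := colax_id X; ralpha := {| nt m := idm (rmon X m) |} |}.
Next Obligation. by move=> *; rewrite comp1m compm1. Qed.
Next Obligation. by move=> *; rewrite /= fmap1 !compm1 comp1m. Qed.
Next Obligation. by move=> *; rewrite /= comp1m. Qed.
Next Obligation.
by move=> *; rewrite /= amap1 fmap1 !compm1 !comp1m.
Qed.

Program Definition rep_comp (V : MonoidalCategory) (X Y Z : Rep0 V)
    (L : Rep1 Y Z) (K : Rep1 X Y) : Rep1 X Z :=
  {| rfun := colax_comp L K;
     ralpha := {| nt m := fmap L (ralpha K m) ∘ ralpha L (K m) |} |}.
Next Obligation.
move=> V X Y Z L K x y f /=.
rewrite -compA (nt_nat (ralpha L)) /= !compA -!fmapM.
by rewrite (nt_nat (ralpha K)).
Qed.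
Next Obligation.
move=> V X Y Z L K m /=.
rewrite -compA ralpha_mu !compA -fmapM ralpha_mu !fmapM -!compA.
do 2 congr (_ ∘ _); rewrite !compA; congr (_ ∘ _).
by rewrite (nt_nat (ralpha L)).
Qed.
Next Obligation.
move=> V X Y Z L K m /=.
by rewrite -compA ralpha_eta -fmapM ralpha_eta.
Qed.
Next Obligation.
move=> V X Y Z L K c m /=.
rewrite amapMr fmapM -!compA.
rewrite (compA (idm c ◇₁ ralpha L _)) (compA _ (fmap (rmon Z) (zeta L _ _))).
rewrite ralpha_law -!compA (nt_nat (ralpha L)) /=.
rewrite (compA (zeta L _ _)) (compA (idm c ◇₁ _)) (compA (idm c ◇₁ _)).
rewrite -zeta_nat -!compA; congr (_ ∘ _); rewrite !compA; congr (_ ∘ _).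
by rewrite -!fmapM ralpha_law.
Qed.

Program Definition rep_hcomp (V : MonoidalCategory) (X Y Z : Rep0 V) :
  Functor (Prod (RepHom Y Z) (RepHom X Y)) (RepHom X Z) :=
  {| fob p := rep_comp (fst p) (snd p);
     fmap p q f := {| rnat := eqnat_hcomp (fst f) (snd f) |} |}.
Next Obligation.
move=> V X Y Z [L K] [L' K'] [t s] m /=.
rewrite fmapM !compA -(compA _ (ralpha L' _)) (rnatP t) -!compA.
rewrite (nt_nat (ralpha L)) /= !compA.
rewrite -(nt_nat t) /= -!compA; congr (_ ∘ _).
by rewrite !compA -!fmapM (rnatP s).
Qed.
Next Obligation.
by move=> V X Y Z [L K]; apply: rep2_ext => m; apply: eqnat_hcomp1.
Qed.
Next Obligation.
move=> V X Y Z [L K] [L' K'] [L'' K''] [t' s'] [t s].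
by apply: rep2_ext => m; apply: eqnat_hcompM.
Qed.

Program Definition Rep (V : MonoidalCategory) : TwoCategory :=
  {| ob2 := Rep0 V;
     hom2 X Y := RepHom X Y;
     id2 X := rep_id X;
     hcomp X Y Z := rep_hcomp X Y Z |}.
Next Obligation.
move=> V X Y Z W.
have E : forall (N : Rep1 Z W) (L : Rep1 Y Z) (K : Rep1 X Y),
    rep_comp (rep_comp N L) K = rep_comp N (rep_comp L K).
  move=> N L K; apply: rep1_ext => //= *; apply: eq_mor_eq.
    by rewrite fmapM compA.
  by rewrite fmapM compA.
apply: functor_ext => -[[N L] K] [[N' L'] K'] [[u t] s].
apply: rep2_mor_eq; [exact: E | exact: E | move=> m].
by apply: eq_mor_eq; apply: eqnat_hcompA.
Qed.
Next Obligation.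
move=> V X Y.
have E : forall K : Rep1 X Y, rep_comp (rep_id Y) K = K.
  move=> K; apply: rep1_ext => //= *; apply: eq_mor_eq.
    by rewrite comp1m.
  by rewrite compm1.
apply: functor_ext => K K' s.
apply: rep2_mor_eq; [exact: E | exact: E | move=> m].
by apply: eq_mor_eq; apply: eqnat_hcomp1m.
Qed.
Next Obligation.
move=> V X Y.
have E : forall K : Rep1 X Y, rep_comp K (rep_id X) = K.
  move=> K; apply: rep1_ext => //= *; apply: eq_mor_eq.
    by rewrite fmap1 compm1.
  by rewrite fmap1 comp1m.
apply: functor_ext => K K' s.
apply: rep2_mor_eq; [exact: E | exact: E | move=> m].
by apply: eq_mor_eq; apply: eqnat_hcompm1.
Qed.

(* An action on the Eilenberg-Moore category for which the forgetful functor is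
   strictly equivariant: [strict eforget] forces U (c ◇ x) = c ◇ U x, as an
   equality of objects, and makes all structure morphisms of U identities. *)
Record EM0 (V : MonoidalCategory) := {
  ecat :> Actegory V;
  emon : Monad ecat;
  eact : Action V (EM emon);
  eforget : @Colax V {| acat := EM emon; aact := eact |} ecat (forgetful emon);
  eforget_strict : strict eforget }.
Arguments emon {V} e.
Arguments eact {V} e.

Definition EMact (V : MonoidalCategory) (X : EM0 V) : Actegory V :=
  {| acat := EM (emon X); aact := eact X |}.

Definition eU (V : MonoidalCategory) (X : EM0 V) : Functor (EMact X) X :=
  forgetful (emon X).

Lemma eU_ob (V : MonoidalCategory) (X : EM0 V) (c : V) (x : EMact X) :
  eU X (c ◇ x) = c ◇ eU X x.
Proof. exact: eq_sym (mor_eq_tgt (eforget_strict c x)). Qed.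

(* The types of the two sides of [elift_zeta] (and of [elnat_eq] below) agree
   only up to the equalities given by [eU_ob] and [elift_fun], hence ≡. *)
Record EM1 (V : MonoidalCategory) (X Y : EM0 V) := {
  ebase :> ColaxFunctor X Y;
  elift : ColaxFunctor (EMact X) (EMact Y);
  elift_fun : fcomp (eU Y) elift = fcomp ebase (eU X);
  elift_zeta : forall (c : V) (x : EMact X),
    fmap (eU Y) (zeta elift c x) ≡ zeta ebase c (eU X x) }.
Arguments elift {V X Y} e.

Lemma elift_ob (V : MonoidalCategory) (X Y : EM0 V) (K : EM1 X Y)
    (x : EMact X) : eU Y (elift K x) = K (eU X x).
Proof. exact: (@functor_eq_ob (EMact X) Y _ _ x (elift_fun K)). Qed.

Lemma elift_map (V : MonoidalCategory) (X Y : EM0 V) (K : EM1 X Y)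
    (x y : EMact X) (f : hom x y) :
  fmap (eU Y) (fmap (elift K) f) ≡ fmap K (fmap (eU X) f).
Proof. exact: (@mor_eq_functor (EMact X) Y _ _ x y f (elift_fun K)). Qed.

Lemma em1_ext (V : MonoidalCategory) (X Y : EM0 V) (K L : EM1 X Y) :
  ebase K = ebase L -> elift K = elift L -> K = L.
Proof.
case: K L => [K H E Z] [K' H' E' Z'] /= EK EH.
by subst K' H'; rewrite (proof_irrelevance _ E E') (proof_irrelevance _ Z Z').
Qed.

Record EM2 (V : MonoidalCategory) (X Y : EM0 V) (K L : EM1 X Y) := {
  ebnat : EqNat K L;
  elnat : EqNat (elift K) (elift L);
  elnat_eq : forall x : EMact X, fmap (eU Y) (elnat x) ≡ ebnat (eU X x) }.

Lemma em2_ext (V : MonoidalCategory) (X Y : EM0 V) (K L : EM1 X Y)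
    (s t : EM2 K L) :
  (forall m, ebnat s m = ebnat t m) -> (forall x, elnat s x = elnat t x) ->
  s = t.
Proof.
case: s t => [s s' sP] [t t' tP] /= H H'.
have E : s = t by exact: eqnat_ext.
have E' : s' = t' by exact: eqnat_ext.
by subst t t'; rewrite (proof_irrelevance _ sP tP).
Qed.

Program Definition EMHom (V : MonoidalCategory) (X Y : EM0 V) : Category :=
  {| ob := EM1 X Y;
     hom K L := EM2 K L;
     idm K := {| ebnat := eqnat_id K; elnat := eqnat_id (elift K) |};
     comp K L P t s := {| ebnat := eqnat_vcomp (ebnat t) (ebnat s);
                          elnat := eqnat_vcomp (elnat t) (elnat s) |} |}.
Next Obligation.
move=> V X Y K x.
exact: (@mor_eq_idm Y _ _ (elift_ob K x)).
Qed.
Next Obligation.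
move=> V X Y K L P t s x.
exact: mor_eq_comp (elnat_eq t x) (elnat_eq s x).
Qed.
Next Obligation. by move=> *; apply: em2_ext => m; apply: compA. Qed.
Next Obligation. by move=> *; apply: em2_ext => m; apply: comp1m. Qed.
Next Obligation. by move=> *; apply: em2_ext => m; apply: compm1. Qed.

Lemma em2_mor_eq (V : MonoidalCategory) (X Y : EM0 V)
    (K L K' L' : EMHom X Y) (s : hom K L) (t : hom K' L') :
  K = K' -> L = L' ->
  (forall m, nt (enat (ebnat s)) m ≡ nt (enat (ebnat t)) m) ->
  (forall x, nt (enat (elnat s)) x ≡ nt (enat (elnat t)) x) -> s ≡ t.
Proof.
move=> EK EL; subst K' L' => H H'.
by apply: eq_mor_eq; apply: em2_ext => m; apply: mor_eq_eq.
Qed.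

Program Definition em_id (V : MonoidalCategory) (X : EM0 V) : EM1 X X :=
  {| ebase := colax_id X; elift := colax_id (EMact X) |}.
Next Obligation. by move=> V X; apply: functor_ext. Qed.
Next Obligation. move=> V X c x; exact: mor_eq_idm (eU_ob c x). Qed.

Program Definition em_comp (V : MonoidalCategory) (X Y Z : EM0 V)
    (L : EM1 Y Z) (K : EM1 X Y) : EM1 X Z :=
  {| ebase := colax_comp L K; elift := colax_comp (elift L) (elift K) |}.
Next Obligation.
move=> V X Y Z L K.
rewrite -[LHS]/(fcomp (eU Z) (fcomp (elift L) (elift K))).
by rewrite -fcompA elift_fun fcompA elift_fun -fcompA.
Qed.
Next Obligation.
move=> V X Y Z L K c x.
apply: (mor_eq_comp (C := Z)).
  apply: mor_eq_trans (elift_zeta L c (elift K x)) _.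
  by rewrite elift_ob.
apply: mor_eq_trans (elift_map L _) _.
exact: mor_eq_fmap (elift_zeta K c x).
Qed.

Program Definition em_hcomp (V : MonoidalCategory) (X Y Z : EM0 V) :
  Functor (Prod (EMHom Y Z) (EMHom X Y)) (EMHom X Z) :=
  {| fob p := em_comp (fst p) (snd p);
     fmap p q f := {| ebnat := eqnat_hcomp (ebnat (fst f)) (ebnat (snd f));
                      elnat := eqnat_hcomp (elnat (fst f)) (elnat (snd f)) |} |}.
Next Obligation.
move=> V X Y Z [L K] [L' K'] [t s] x.
apply: (mor_eq_comp (C := Z)).
  apply: mor_eq_trans (elnat_eq t (elift K' x)) _.
  by rewrite elift_ob.
apply: mor_eq_trans (elift_map L _) _.
exact: mor_eq_fmap (elnat_eq s x).
Qed.
Next Obligation.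
by move=> V X Y Z [L K]; apply: em2_ext => m; apply: eqnat_hcomp1.
Qed.
Next Obligation.
move=> V X Y Z [L K] [L' K'] [L'' K''] [t' s'] [t s].
by apply: em2_ext => m; apply: eqnat_hcompM.
Qed.

(* 0-cells EM0, 1-cells EM1, 2-cells EM2, with componentwise compositions. *)
Program Definition EMLift (V : MonoidalCategory) : TwoCategory :=
  {| ob2 := EM0 V;
     hom2 X Y := EMHom X Y;
     id2 X := em_id X;
     hcomp X Y Z := em_hcomp X Y Z |}.
Next Obligation.
move=> V X Y Z W.
have E : forall (N : EM1 Z W) (L : EM1 Y Z) (K : EM1 X Y),
    em_comp (em_comp N L) K = em_comp N (em_comp L K).
  by move=> N L K; apply: em1_ext; apply: colax_compA.
apply: functor_ext => -[[N L] K] [[N' L'] K'] [[u t] s].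
by apply: em2_mor_eq; [exact: E | exact: E | |] => m;
  apply: eq_mor_eq; apply: eqnat_hcompA.
Qed.
Next Obligation.
move=> V X Y.
have E : forall K : EM1 X Y, em_comp (em_id Y) K = K.
  by move=> K; apply: em1_ext; apply: colax_comp1m.
apply: functor_ext => K K' s.
by apply: em2_mor_eq; [exact: E | exact: E | |] => m;
  apply: eq_mor_eq; apply: eqnat_hcomp1m.
Qed.
Next Obligation.
move=> V X Y.
have E : forall K : EM1 X Y, em_comp K (em_id X) = K.
  by move=> K; apply: em1_ext; apply: colax_compm1.
apply: functor_ext => K K' s.
by apply: em2_mor_eq; [exact: E | exact: E | |] => m;
  apply: eq_mor_eq; apply: eqnat_hcompm1.
Qed.

(* Main.v *)
From Stdlib Require Import ssreflect FunctionalExtensionality ProofIrrelevance.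
Require Import Defs.

Set Implicit Arguments.
Unset Strict Implicit.
Unset Printing Implicit Defensive.
#[local] Obligation Tactic := try (by intros); simpl.
Local Open Scope cat_scope.

(** Everything rests on the correspondence between liftings and monad maps. Let
    [S], [T] be monads on [M], [N] and [K : M -> N] a functor. A functor [H]
    between the Eilenberg-Moore categories with [U H = K U] on the nose is the
    same thing as a [MonadMap], a natural transformation [a : T K => K S]
    compatible with multiplications and units. From [a] one gets [H] by giving
    the image under [K] of the carrier of [x] the action [K (maction x) ∘ a x] ([lift_functor]); from [H] one gets
    [a m] by restricting the action of [H] on the free module [S m] along
    [T K (eta m)] ([map_of_lift]). The second passage loses nothing because the
    action of any module [x] is a module map from the free module on [x], hence
    [H] carries it to a module map, and this determines the action of [H x]
    ([lift_actionE], [lift_moduleE]). In the other order, [a] comes back by its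
    naturality and a unit law of [S] ([lift_nat_lift]).

    For a fixed object [c], taking [K] to be [c ◇ _] turns an action on the
    modules for which [U] is strictly equivariant into maps
    [S (c ◇ m) -> c ◇ S m] satisfying the two monad axioms of a distributive law. The remaining axioms correspond one by
    one: the naturality in [c], the unit and the associativity axiom of the law
    hold because the maps [f ◇₁ g], [aunit] and [aassoc] of the lifted action
    are module maps lying over those of the base. This gives the bijection on
    0-cells. The correspondence for the functor of a 1-cell gives the bijection
    on 1-cells, the law axiom of a 1-cell saying that each [zeta K c x] is a map
    of modules ([lift_nat_law]); and the axiom of a 2-cell says that its
    components are maps of modules.

    A 2-functor with a two-sided inverse on objects and two-sided inverses of
    its hom-functors is an isomorphism ([two_isomorphic_of_inverses]), so it
    remains to assemble one 2-functor, [rep_to_em]. The inverses of its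
    hom-functors are only needed between 0-cells in its image, where the action
    on modules is the explicit one and lies over the base by computation. *)

(** * Morphisms with equal, not necessarily convertible, endpoints *)

Lemma mor_eq_src (C : Category) (x y x' y' : C) (f : hom x y)
    (g : hom x' y') : f ≡ g -> x = x'.
Proof. by case. Qed.

Lemma mor_eq_idl (C : Category) (a x y z : C) (g : hom y z) (f : hom x y) :
  g ≡ idm a -> g ∘ f ≡ f.
Proof.
move=> E; have Ea := mor_eq_src E; have Ez := mor_eq_tgt E; subst a z.
by rewrite (mor_eq_eq E) comp1m.
Qed.

Lemma mor_eq_idr (C : Category) (a x y z : C) (g : hom y z) (f : hom x y) :
  f ≡ idm a -> g ∘ f ≡ g.
Proof.
move=> E; have Ea := mor_eq_tgt E; have Ez := mor_eq_src E; subst a x.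
by rewrite (mor_eq_eq E) compm1.
Qed.

Lemma mor_eq_amap (V : MonoidalCategory) (N : Actegory V) (c c' : V)
    (f : hom c c') (x y x' y' : N) (g : hom x y) (g' : hom x' y') :
  g ≡ g' -> f ◇₁ g ≡ f ◇₁ g'.
Proof. by case. Qed.

(** * Modules over a monad *)

Lemma module_ext (M : Category) (T : Monad M) (X Y : Module T) :
  carrier X = carrier Y -> maction X ≡ maction Y -> X = Y.
Proof.
case: X Y => [x a am ae] [y b bm be] /= E; subst y => /mor_eq_eq E; subst b.
by rewrite (proof_irrelevance _ am bm) (proof_irrelevance _ ae be).
Qed.

Lemma em_mor_eq (M : Category) (T : Monad M) (X Y X' Y' : EM T)
    (f : hom X Y) (g : hom X' Y') :
  X = X' -> Y = Y' -> mmap f ≡ mmap g -> f ≡ g.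
Proof.
move=> EX EY; subst X' Y' => /mor_eq_eq E.
by apply: eq_mor_eq; apply: modulemap_ext.
Qed.

Lemma em_iso (M : Category) (T : Monad M) (X Y : EM T) (f : hom X Y) :
  is_iso (mmap f) -> is_iso f.
Proof.
move=> [g [gf fg]].
have gP : g ∘ maction Y = maction X ∘ fmap T g.
  rewrite -[LHS]compm1 -fmap1 -fg fmapM -compA (compA (maction Y)) -(mmapP f).
  by rewrite !compA gf comp1m.
by exists (Build_ModuleMap gP); split; apply: modulemap_ext.
Qed.

(** The carrier of a lifted module is only propositionally equal to the object
    that it lies over; this is its action transported to that object. *)
Definition cast_action (M : Category) (T : Monad M) (N : Module T) (n : M)
    (e : carrier N = n) : hom (T n) n :=
  match e in _ = n return hom (T n) n with eq_refl => maction N end.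

Lemma cast_action_eq (M : Category) (T : Monad M) (N : Module T) (n : M)
    (e : carrier N = n) : maction N ≡ cast_action e.
Proof. by case: n / e. Qed.

Lemma cast_action_map (M : Category) (T : Monad M) (X Y : Module T) (x y : M)
    (ex : carrier X = x) (ey : carrier Y = y) (f : ModuleMap X Y)
    (g : hom x y) : mmap f ≡ g ->
  g ∘ cast_action ex = cast_action ey ∘ fmap T g.
Proof.
by subst x y => /mor_eq_eq <- /=; apply: mmapP.
Qed.

Program Definition free_module (M : Category) (T : Monad M) (m : M) :
  Module T := {| carrier := T m; maction := mu T m |}.
Next Obligation. by move=> *; rewrite mu_assoc. Qed.
Next Obligation. by move=> *; rewrite mu_unitl. Qed.

Program Definition free_map (M : Category) (T : Monad M) (x y : M)
    (f : hom x y) : ModuleMap (free_module T x) (free_module T y) :=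
  {| mmap := fmap T f |}.
Next Obligation. by move=> M T x y f; rewrite -(nt_nat (mu T)). Qed.

Program Definition action_map (M : Category) (T : Monad M) (X : Module T) :
  ModuleMap (free_module T X) X := {| mmap := maction X |}.
Next Obligation. by move=> *; rewrite maction_mu. Qed.

(** * Monad maps and liftings to modules *)

(** For [K] a 1-cell of representations this is the transformation of the
    1-cell; for [K] the functor [c ◇ _] it is the component at [c] of a
    distributive law. *)
Record MonadMap (M N : Category) (S : Monad M) (T : Monad N)
    (K : Functor M N) := {
  mm :> NatTrans (fcomp T K) (fcomp K S);
  mm_mu : forall m : M,
    mm m ∘ mu T (K m) = fmap K (mu S m) ∘ mm (S m) ∘ fmap T (mm m);
  mm_eta : forall m : M, mm m ∘ eta T (K m) = fmap K (eta S m) }.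

Program Definition lift_module (M N : Category) (S : Monad M) (T : Monad N)
    (K : Functor M N) (a : MonadMap S T K) (x : Module S) : Module T :=
  {| carrier := K x; maction := fmap K (maction x) ∘ a x |}.
Next Obligation.
move=> M N S T K a x.
rewrite -(compA _ (a x) (mu T _)) mm_mu !compA -fmapM -maction_mu !fmapM.
rewrite -!compA; congr (_ ∘ _); rewrite !compA; congr (_ ∘ _).
by rewrite (nt_nat a).
Qed.
Next Obligation.
by move=> M N S T K a x; rewrite -compA mm_eta -fmapM maction_eta fmap1.
Qed.

Lemma cast_lift_module (M N : Category) (S : Monad M) (T : Monad N)
    (K : Functor M N) (a : MonadMap S T K) (X : Module S) (x : M)
    (e : carrier X = x) (e' : carrier (lift_module a X) = K x) :
  cast_action e' = fmap K (cast_action e) ∘ a x.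
Proof. by subst x; rewrite (proof_irrelevance _ e' eq_refl). Qed.

Program Definition lift_functor (M N : Category) (S : Monad M) (T : Monad N)
    (K : Functor M N) (a : MonadMap S T K) : Functor (EM S) (EM T) :=
  {| fob := lift_module a : EM S -> EM T;
     fmap x y f := {| mmap := fmap K (mmap f) |} |}.
Next Obligation.
move=> M N S T K a x y f /=.
by rewrite compA -fmapM mmapP fmapM -!compA (nt_nat a).
Qed.
Next Obligation. by move=> *; apply: modulemap_ext; apply: fmap1. Qed.
Next Obligation. by move=> *; apply: modulemap_ext; apply: fmapM. Qed.

Lemma lift_ob (M N : Category) (S : Monad M) (T : Monad N) (K : Functor M N)
    (H : Functor (EM S) (EM T))
    (E : fcomp (forgetful T) H = fcomp K (forgetful S)) (x : EM S) :
  carrier (H x) = K (carrier x).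
Proof. exact: (functor_eq_ob x E). Qed.

Lemma lift_mor (M N : Category) (S : Monad M) (T : Monad N) (K : Functor M N)
    (H : Functor (EM S) (EM T))
    (E : fcomp (forgetful T) H = fcomp K (forgetful S)) (x y : EM S)
    (f : hom x y) : mmap (fmap H f) ≡ fmap K (mmap f).
Proof. exact: (mor_eq_functor f E). Qed.

Definition lift_action (M N : Category) (S : Monad M) (T : Monad N)
    (K : Functor M N) (H : Functor (EM S) (EM T))
    (E : fcomp (forgetful T) H = fcomp K (forgetful S)) (x : EM S) :
  hom (T (K (carrier x))) (K (carrier x)) := cast_action (lift_ob E x).

Lemma lift_action_map (M N : Category) (S : Monad M) (T : Monad N)
    (K : Functor M N) (H : Functor (EM S) (EM T))
    (E : fcomp (forgetful T) H = fcomp K (forgetful S)) (x y : EM S)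
    (f : ModuleMap x y) :
  fmap K f ∘ lift_action E x = lift_action E y ∘ fmap T (fmap K f).
Proof. exact: cast_action_map (lift_mor E f). Qed.

Lemma cast_action_mu (M : Category) (T : Monad M) (X : Module T) (x : M)
    (e : carrier X = x) :
  cast_action e ∘ mu T x = cast_action e ∘ fmap T (cast_action e).
Proof. by subst x; rewrite /= maction_mu. Qed.

Lemma cast_action_eta (M : Category) (T : Monad M) (X : Module T) (x : M)
    (e : carrier X = x) : cast_action e ∘ eta T x = idm x.
Proof. by subst x; apply: maction_eta. Qed.

Program Definition lift_nat (M N : Category) (S : Monad M) (T : Monad N)
    (K : Functor M N) (H : Functor (EM S) (EM T))
    (E : fcomp (forgetful T) H = fcomp K (forgetful S)) :
  NatTrans (fcomp T K) (fcomp K S) :=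
  {| nt m := lift_action E (free_module S m) ∘ fmap T (fmap K (eta S m)) |}.
Next Obligation.
move=> M N S T K H E x y f /=.
rewrite compA (lift_action_map E (free_map S f)) -!compA -!fmapM.
by rewrite (nt_nat (eta S)).
Qed.

(** [maction x] is a module map from the free module on [x], split by the unit
    of [x]. Being carried by [H] to a module map, it expresses the action of
    [H x] through the action of [H] on that free module. *)
Lemma lift_actionE (M N : Category) (S : Monad M) (T : Monad N)
    (K : Functor M N) (H : Functor (EM S) (EM T))
    (E : fcomp (forgetful T) H = fcomp K (forgetful S)) (x : Module S) :
  lift_action E x = fmap K (maction x) ∘ lift_nat E x.
Proof.
rewrite /= compA (lift_action_map E (action_map x)) -compA -!fmapM /=.
by rewrite maction_eta !fmap1 compm1.
Qed.

Program Definition map_of_lift (M N : Category) (S : Monad M) (T : Monad N)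
    (K : Functor M N) (H : Functor (EM S) (EM T))
    (E : fcomp (forgetful T) H = fcomp K (forgetful S)) : MonadMap S T K :=
  {| mm := lift_nat E |}.
Next Obligation.
move=> M N S T K H E m.
rewrite -(lift_actionE E (free_module S m)) /=.
rewrite -compA -(nt_nat (mu T)) compA [in LHS]/lift_action cast_action_mu.
by rewrite -compA -fmapM.
Qed.
Next Obligation.
move=> M N S T K H E m /=.
by rewrite -compA -(nt_nat (eta T)) compA cast_action_eta comp1m.
Qed.

Lemma lift_moduleE (M N : Category) (S : Monad M) (T : Monad N)
    (K : Functor M N) (H : Functor (EM S) (EM T))
    (E : fcomp (forgetful T) H = fcomp K (forgetful S))
    (a : MonadMap S T K) : (forall m, a m = lift_nat E m) ->
  forall x : Module S, lift_module a x = H x.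
Proof.
move=> Ea x; apply: module_ext; first exact: eq_sym (lift_ob E x).
apply: mor_eq_sym; apply: mor_eq_trans (cast_action_eq (lift_ob E x)) _.
by apply: eq_mor_eq; rewrite /= Ea -lift_actionE.
Qed.

(** The hypothesis compares [H] with the lifting of [a] on objects only, so that
    it also applies when [H] is a translation functor of a lifted action, whose
    functor laws have other proofs than those of [lift_functor]. *)
Lemma lift_nat_lift (M N : Category) (S : Monad M) (T : Monad N)
    (K : Functor M N) (a : MonadMap S T K) (H : Functor (EM S) (EM T))
    (E : fcomp (forgetful T) H = fcomp K (forgetful S)) :
  (forall x : Module S, H x = lift_module a x) ->
  forall m : M, lift_nat E m = a m.
Proof.
move=> EH m.
have -> : lift_nat E m = lift_action E (free_module S m)
    ∘ fmap T (fmap K (eta S m)) by [].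
have -> : lift_action E (free_module S m) = fmap K (mu S m) ∘ a (S m).
  rewrite /lift_action; move: (lift_ob _ _); rewrite EH => e.
  by rewrite (proof_irrelevance _ e eq_refl).
by rewrite -compA (nt_nat a) /= compA -fmapM mu_unitr fmap1 comp1m.
Qed.

(** The form of [lift_actionE] for a module that is itself obtained by lifting,
    so that its carrier has to be transported as well; it computes the
    actions of modules such as [c ◇ (d ◇ x)]. *)
Lemma cast_lift (M N : Category) (S : Monad M) (T : Monad N)
    (K : Functor M N) (H : Functor (EM S) (EM T))
    (E : fcomp (forgetful T) H = fcomp K (forgetful S)) (X : Module S) (x : M)
    (e : carrier X = x) (e' : carrier (H X) = K x) :
  cast_action e' = fmap K (cast_action e) ∘ lift_nat E x.
Proof.
subst x; rewrite -lift_actionE /lift_action.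
by rewrite (proof_irrelevance _ e' (lift_ob E X)).
Qed.

(** * Actions on modules from distributive laws *)

Program Definition translate (V : MonoidalCategory) (N : Actegory V) (c : V) :
  Functor N N := {| fob m := c ◇ m; fmap x y f := idm c ◇₁ f |}.
Next Obligation. by move=> *; apply: amap1. Qed.
Next Obligation. by move=> *; apply: amapMr. Qed.

Program Definition law_map (V : MonoidalCategory) (X : Rep0 V) (c : V) :
  MonadMap (rmon X) (rmon X) (translate X c) :=
  {| mm := {| nt m := zeta (rlaw X) c m |} |}.
Next Obligation. by move=> *; apply: zeta_nat. Qed.
Next Obligation. by move=> *; apply: rlaw_mu. Qed.
Next Obligation. by move=> *; apply: rlaw_eta. Qed.

Program Definition lift_act (V : MonoidalCategory) (X : Rep0 V) :
  Functor (Prod V (EM (rmon X))) (EM (rmon X)) :=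
  {| fob p := lift_module (law_map X (fst p)) (snd p) : EM (rmon X);
     fmap p q f := {| mmap := fst f ◇₁ mmap (snd f) |} |}.
Next Obligation.
move=> V X [c x] [d y] [f g] /=.
rewrite compA -amapM compm1 mmapP -compA zeta_nat compA -amapM.
by rewrite comp1m.
Qed.
Next Obligation. by move=> *; apply: modulemap_ext; apply: amap1. Qed.
Next Obligation. by move=> *; apply: modulemap_ext; apply: amapM. Qed.

Lemma aassoc_natr (V : MonoidalCategory) (N : Actegory V) (c d : V) (x y : N)
    (g : hom x y) :
  aassoc c d y ∘ (idm (c ⊗ d) ◇₁ g) = (idm c ◇₁ (idm d ◇₁ g)) ∘ aassoc c d x.
Proof.
rewrite /amap -(actA_nat (aact N)) /aassoc; congr (_ ∘ bimap _ _ _).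
exact: eq_sym (fmap1 (tens V) (c, d)).
Qed.

Lemma aunit_nat (V : MonoidalCategory) (N : Actegory V) (x y : N)
    (g : hom x y) : aunit y ∘ (idm tunit ◇₁ g) = g ∘ aunit x.
Proof. exact: (actU_nat (aact N)). Qed.

Program Definition lift_action_of_law (V : MonoidalCategory) (X : Rep0 V) :
  Action V (EM (rmon X)) :=
  {| act := lift_act X;
     actA c d x := {| mmap := aassoc c d (carrier x) |};
     actU x := {| mmap := aunit (carrier x) |} |}.
Next Obligation.
move=> V X c d x /=.
rewrite compA aassoc_natr -compA zeta_assoc !compA; congr (_ ∘ _).
by rewrite amapMr.
Qed.
Next Obligation.
move=> V X x /=.
by rewrite compA aunit_nat -compA zeta_unit.
Qed.
Next Obligation. by move=> *; apply: em_iso; apply: actA_iso. Qed.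
Next Obligation. by move=> *; apply: em_iso; apply: actU_iso. Qed.
Next Obligation. by move=> *; apply: modulemap_ext; apply: actA_nat. Qed.
Next Obligation. by move=> *; apply: modulemap_ext; apply: actU_nat. Qed.
Next Obligation. by move=> *; apply: modulemap_ext; apply: act_pentagon. Qed.
Next Obligation. by move=> *; apply: modulemap_ext; apply: act_lunit. Qed.
Next Obligation. by move=> *; apply: modulemap_ext; apply: act_runit. Qed.

Program Definition em0_of_rep0 (V : MonoidalCategory) (X : Rep0 V) : EM0 V :=
  {| ecat := X; emon := rmon X; eact := lift_action_of_law X;
     eforget := {| zeta c m := idm (c ◇ carrier m) |} |}.
Next Obligation. by move=> *; rewrite /= comp1m compm1. Qed.
Next Obligation. by move=> *; rewrite /= compm1. Qed.
Next Obligation. by move=> *; rewrite /= amap1 !compm1 !comp1m. Qed.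

(** * Distributive laws from actions on modules *)

(** The structure of the forgetful functor consists of identities, so its
    naturality and its unit and associativity axioms become equalities between
    the action on modules and that on the base. *)
Lemma strict_map (V : MonoidalCategory) (X : EM0 V) (c d : V)
    (x y : EMact X) (f : hom c d) (g : hom x y) :
  mmap (f ◇₁ g) ≡ f ◇₁ mmap g.
Proof.
apply: (mor_eq_trans (C := X)).
  apply: mor_eq_sym; apply: (mor_eq_idl (C := X)).
  exact: (eforget_strict d y).
rewrite (zeta_nat (eforget X) f g).
exact: (mor_eq_idr (C := X)) (eforget_strict c x).
Qed.

Lemma strict_unit (V : MonoidalCategory) (X : EM0 V) (x : EMact X) :
  mmap (aunit x) ≡ aunit (eU X x).
Proof.
rewrite -[mmap _]/(fmap (forgetful (emon X)) (aunit x)).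
rewrite -(zeta_unit (eforget X) x).
exact: (mor_eq_idr (C := X)) (eforget_strict tunit x).
Qed.

Lemma strict_assoc (V : MonoidalCategory) (X : EM0 V) (c d : V)
    (x : EMact X) : mmap (aassoc c d x) ≡ aassoc c d (eU X x).
Proof.
apply: mor_eq_sym; apply: (mor_eq_trans (C := X)).
  apply: mor_eq_sym.
  apply: (mor_eq_idr (C := X)) (eforget_strict (c ⊗ d) x).
rewrite (zeta_assoc (eforget X) c d x) -compA.
apply: (mor_eq_trans (C := X)).
  apply: (mor_eq_idl (C := X) (a := c ◇ eU X (d ◇ x))).
  by rewrite -amap1; apply: mor_eq_amap (eforget_strict d x).
exact: (mor_eq_idl (C := X)) (eforget_strict c (d ◇ x)).
Qed.

Lemma translate_lifts (V : MonoidalCategory) (X : EM0 V) (c : V) :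
  fcomp (eU X) (translate (EMact X) c) = fcomp (translate X c) (eU X).
Proof. by apply: functor_ext => x y f; apply: strict_map. Qed.

(** [aassoc c d F], for [F] the free module on [m], is a map of modules from
    [(c ⊗ d) ◇ F] to [c ◇ (d ◇ F)]; the action of the latter is built from the
    laws for [c] and [d]. Restricting along the unit of [m] gives the axiom. *)
Lemma law_of_em0_assoc (V : MonoidalCategory) (X : EM0 V) (c d : V) (m : X) :
  aassoc c d (emon X m) ∘ lift_nat (translate_lifts X (c ⊗ d)) m =
  (idm c ◇₁ lift_nat (translate_lifts X d) m)
    ∘ lift_nat (translate_lifts X c) (d ◇ m) ∘ fmap (emon X) (aassoc c d m).
Proof.
set S := emon X; set F : EMact X := free_module S m.
have e : eU X (c ◇ (d ◇ F)) = c ◇ (d ◇ eU X F) by rewrite !eU_ob.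
have E (b : V) (n : X) : lift_nat (translate_lifts X b) n =
    lift_action (translate_lifts X b) (free_module S n)
      ∘ fmap S (idm b ◇₁ eta S n) by [].
rewrite (E (c ⊗ d)) (E d) compA.
(* The structure isomorphism is a map of modules at the free module. *)
rewrite (cast_action_map _ e (strict_assoc c d F)).
rewrite (cast_lift (translate_lifts X c) (lift_ob (translate_lifts X d) F) e).
have := nt_nat (lift_nat (translate_lifts X c)) (idm d ◇₁ eta S m).
move: (lift_nat (translate_lifts X c)) => l /= ln.
rewrite amapMr -!compA; congr (_ ∘ _).
by rewrite -fmapM aassoc_natr fmapM !compA ln.
Qed.

Program Definition law_of_em0 (V : MonoidalCategory) (X : EM0 V) :
  Colax (emon X) :=
  {| zeta c m := lift_nat (translate_lifts X c) m |}.
Next Obligation.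
move=> V X c d x y f g /=.
set S := emon X.
have E := strict_map f (free_map S g : @hom (EMact X) _ _).
rewrite compA (cast_action_map _ (lift_ob (translate_lifts X d) _) E).
rewrite -!compA -2!(fmapM S); congr (_ ∘ fmap _ _).
by rewrite -!amapM comp1m compm1 (nt_nat (eta S) g).
Qed.
Next Obligation.
move=> V X m /=.
set S := emon X.
have E := strict_unit (free_module S m : EMact X).
rewrite compA (cast_action_map _ eq_refl E) /= -compA -fmapM aunit_nat.
by rewrite fmapM compA mu_unitr comp1m.
Qed.
Next Obligation. by move=> V X c d m; apply: law_of_em0_assoc. Qed.

Program Definition rep0_of_em0 (V : MonoidalCategory) (X : EM0 V) : Rep0 V :=
  {| rcat := X; rmon := emon X; rlaw := law_of_em0 X |}.
Next Obligation.
by move=> V X c m; apply: (mm_mu (map_of_lift (translate_lifts X c))).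
Qed.
Next Obligation.
by move=> V X c m; apply: (mm_eta (map_of_lift (translate_lifts X c))).
Qed.

Lemma colax_structure_ext (V : MonoidalCategory) (M N : Actegory V)
    (F : Functor M N) (z z' : Colax F) :
  (forall c m, zeta z c m = zeta z' c m) -> z = z'.
Proof.
case: z z' => [z zn zu za] [z' zn' zu' za'] /= E.
have Ez : z = z'.
  by do 2!(apply: functional_extensionality_dep => ?); apply: E.
by subst z'; congr Build_Colax; apply: proof_irrelevance.
Qed.

Lemma rep0_ext (V : MonoidalCategory) (M : Actegory V) (S : Monad M)
    (l l' : Colax S) lm lm' le le' :
  (forall c m, zeta l c m = zeta l' c m) ->
  @Build_Rep0 V M S l lm le = @Build_Rep0 V M S l' lm' le'.
Proof.
move=> /colax_structure_ext E; subst l'.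
by congr Build_Rep0; apply: proof_irrelevance.
Qed.

(** A strict structure has only identities as components, so it is determined by
    the action that it is a structure for. *)
Lemma em0_ext (V : MonoidalCategory) (M : Actegory V) (S : Monad M)
    (a b : Action V (EM S)) U U' sU sU' :
  a = b -> @Build_EM0 V M S a U sU = @Build_EM0 V M S b U' sU'.
Proof.
move=> E; subst b.
have E : U = U'.
  apply: colax_structure_ext => c m; apply: mor_eq_eq.
  exact: mor_eq_trans (sU c m) (mor_eq_sym (sU' c m)).
by subst U'; congr Build_EM0; apply: proof_irrelevance.
Qed.

Lemma action_ext (V : MonoidalCategory) (N : Category) (a b : Action V N) :
  (forall p q (f : hom p q), fmap (act a) f ≡ fmap (act b) f) ->
  (forall c d x, actA a c d x ≡ actA b c d x) ->
  (forall x, actU a x ≡ actU b x) -> a = b.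
Proof.
case: a b => [a aA aU ? ? ? ? ? ? ?] [b bA bU ? ? ? ? ? ? ?] /= H.
have E : a = b by exact: functor_ext.
subst b => HA HU.
have E : aA = bA.
  do 3!(apply: functional_extensionality_dep => ?); exact: mor_eq_eq.
subst bA.
have E : aU = bU by apply: functional_extensionality_dep => ?; exact: mor_eq_eq.
subst bU.
by congr Build_Action; apply: proof_irrelevance.
Qed.

Lemma rep0_of_em0_of_rep0 (V : MonoidalCategory) (X : Rep0 V) :
  rep0_of_em0 (em0_of_rep0 X) = X.
Proof.
apply: rep0_ext => c m.
exact: (lift_nat_lift (a := law_map X c)) => //.
Qed.

Lemma em0_of_rep0_of_em0 (V : MonoidalCategory) (X : EM0 V) :
  em0_of_rep0 (rep0_of_em0 X) = X.
Proof.
have E (c : V) (x : EMact X) :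
    lift_module (law_map (rep0_of_em0 X) c) x = c ◇ x.
  exact: (lift_moduleE (E := translate_lifts X c)).
apply: em0_ext; apply: action_ext => [[c x] [d y] [f g]|c d x|x].
- apply: em_mor_eq; [exact: E | exact: E | ].
  exact: mor_eq_sym (strict_map f g).
- apply: em_mor_eq; [exact: E | | exact: mor_eq_sym (strict_assoc c d x)].
  exact: eq_trans (E c _) (f_equal (aob (N := EMact X) c) (E d x)).
- apply: em_mor_eq => //; first exact: E.
  exact: mor_eq_sym (strict_unit x).
Qed.

(** * The 2-functor from representations to liftings *)

Program Definition rep1_map (V : MonoidalCategory) (X Y : Rep0 V)
    (K : Rep1 X Y) : MonadMap (rmon X) (rmon Y) K := {| mm := ralpha K |}.
Next Obligation. by move=> *; apply: ralpha_mu. Qed.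
Next Obligation. by move=> *; apply: ralpha_eta. Qed.

Program Definition rep1_lift (V : MonoidalCategory) (X Y : Rep0 V)
    (K : Rep1 X Y) :
  ColaxFunctor (EMact (em0_of_rep0 X)) (EMact (em0_of_rep0 Y)) :=
  {| cfun := lift_functor (rep1_map K);
     cstr := {| zeta c x := {| mmap := zeta K c (carrier x) |} |} |}.
Next Obligation.
move=> V X Y K c x /=.
rewrite fmapM -!compA (compA (zeta _ _ _)).
rewrite zeta_nat amapMr -!compA; congr (_ ∘ _).
by rewrite !compA -ralpha_law.
Qed.
Next Obligation. by move=> *; apply: modulemap_ext; apply: zeta_nat. Qed.
Next Obligation. by move=> *; apply: modulemap_ext; apply: zeta_unit. Qed.
Next Obligation. by move=> *; apply: modulemap_ext; apply: zeta_assoc. Qed.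

Program Definition em1_of_rep1 (V : MonoidalCategory) (X Y : Rep0 V)
    (K : Rep1 X Y) : EM1 (em0_of_rep0 X) (em0_of_rep0 Y) :=
  {| ebase := rfun K; elift := rep1_lift K |}.
Next Obligation. by move=> *; apply: functor_ext. Qed.

Program Definition em2_of_rep2 (V : MonoidalCategory) (X Y : Rep0 V)
    (K L : Rep1 X Y) (s : Rep2 K L) : EM2 (em1_of_rep1 K) (em1_of_rep1 L) :=
  {| ebnat := rnat s;
     elnat := {| enat := {| nt x := {| mmap := s (carrier x) |} |} |} |}.
Next Obligation.
move=> V X Y K L s x /=.
by rewrite compA (nt_nat s) -!compA rnatP.
Qed.
Next Obligation. by move=> *; apply: modulemap_ext; apply: nt_nat. Qed.
Next Obligation. by move=> *; apply: modulemap_ext; apply: enat_eq. Qed.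

Program Definition rep_to_em_hom (V : MonoidalCategory) (X Y : Rep0 V) :
  Functor (RepHom X Y) (EMHom (em0_of_rep0 X) (em0_of_rep0 Y)) :=
  {| fob := @em1_of_rep1 V X Y : RepHom X Y -> EMHom _ _;
     fmap K L s := em2_of_rep2 s |}.
Next Obligation.
by move=> *; apply: em2_ext => // x; apply: modulemap_ext.
Qed.
Next Obligation.
by move=> *; apply: em2_ext => // x; apply: modulemap_ext.
Qed.

Lemma em1_of_rep_id (V : MonoidalCategory) (X : Rep0 V) :
  em1_of_rep1 (rep_id X) = em_id (em0_of_rep0 X).
Proof.
have E (x : EMact (em0_of_rep0 X)) : lift_module (rep1_map (rep_id X)) x = x.
  by apply: module_ext => //; apply: eq_mor_eq; apply: compm1.
apply: em1_ext => //; apply: colax_ext => [x y f|c x].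
  exact: (em_mor_eq (E x) (E y)).
apply: em_mor_eq; [exact: E | | exact: mor_refl].
exact (f_equal (aob (N := EMact (em0_of_rep0 X)) c) (E x)).
Qed.

Lemma em1_of_rep_comp (V : MonoidalCategory) (X Y Z : Rep0 V)
    (L : Rep1 Y Z) (K : Rep1 X Y) :
  em1_of_rep1 (rep_comp L K) = em_comp (em1_of_rep1 L) (em1_of_rep1 K).
Proof.
have E (x : EMact (em0_of_rep0 X)) :
    lift_module (rep1_map (rep_comp L K)) x =
    lift_module (rep1_map L) (lift_module (rep1_map K) x).
  by apply: module_ext => //; apply: eq_mor_eq; rewrite /= fmapM compA.
apply: em1_ext => //; apply: colax_ext => [x y f|c x].
  exact: (em_mor_eq (E x) (E y)).
apply: em_mor_eq; [exact: E | | exact: mor_refl].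
exact (f_equal (aob (N := EMact (em0_of_rep0 Z)) c) (E x)).
Qed.

Program Definition rep_to_em (V : MonoidalCategory) :
  TwoFunctor (Rep V) (EMLift V) :=
  {| tf0 := @em0_of_rep0 V : Rep V -> EMLift V;
     tf1 X Y := rep_to_em_hom X Y |}.
Next Obligation. by move=> V X; apply: em1_of_rep_id. Qed.
Next Obligation.
move=> V X Y Z; apply: functor_ext => -[L K] [L' K'] [t s].
apply: em2_mor_eq; [exact: em1_of_rep_comp | exact: em1_of_rep_comp | | ].
  by move=> m; apply: mor_refl.
move=> x.
have E A B : lift_module (rep1_map (rep_comp A B)) x =
    lift_module (rep1_map A) (lift_module (rep1_map B) x).
  exact: (f_equal (fun H : EM1 _ _ => elift H x) (em1_of_rep_comp A B)).
by apply: em_mor_eq; [exact: E | exact: E | exact: mor_refl].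
Qed.

(** * Representations from liftings, on 1-cells and 2-cells *)

(** On the free module on [m], [zeta] of the lifting is a map of modules over
    [zeta K c (S m)]. Expanding the action of its source by the monad
    map and that of its target by the law, and restricting along the unit of [m], gives the axiom. *)
Lemma lift_nat_law (V : MonoidalCategory) (X Y : Rep0 V)
    (K : EM1 (em0_of_rep0 X) (em0_of_rep0 Y)) (c : V) (m : X) :
  (idm c ◇₁ lift_nat (elift_fun K) m) ∘ zeta (rlaw Y) c (K m)
    ∘ fmap (rmon Y) (zeta K c m) =
  zeta K c (rmon X m) ∘ fmap K (zeta (rlaw X) c m)
    ∘ lift_nat (elift_fun K) (c ◇ m).
Proof.
set S := rmon X; set T := rmon Y; set F := free_module S m.
set cF : EMact (em0_of_rep0 X) := c ◇ (F : EMact (em0_of_rep0 X)).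
set h := lift_action (elift_fun K).
have hE : h cF = fmap K (maction cF) ∘ lift_nat (elift_fun K) (c ◇ S m).
  exact: lift_actionE.
have am : lift_nat (elift_fun K) m = h F ∘ fmap T (fmap K (eta S m)) by [].
have ln := nt_nat (lift_nat (elift_fun K)) (idm c ◇₁ eta S m).
(* The module map condition on [zeta] of the lifting, seen over the base. *)
have zE : zeta K c (S m) ∘ h cF =
    (idm c ◇₁ h F) ∘ zeta (rlaw Y) c (K (S m)) ∘ fmap T (zeta K c (S m)).
  have ey : carrier (c ◇ (elift K F : EMact (em0_of_rep0 Y))) = c ◇ K (S m).
    exact (f_equal (aob c) (lift_ob (elift_fun K) F)).
  rewrite (cast_action_map _ ey (elift_zeta K c F)).
  by rewrite (cast_lift_module (a := law_map Y c) (lift_ob (elift_fun K) F) ey).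
rewrite am.
move: (lift_nat _) hE ln => l /= hE ln.
rewrite amapMr -(compA _ _ (zeta (rlaw Y) c (K m))) -zeta_nat !compA.
rewrite -(compA _ _ (fmap T (zeta K c m))) -fmapM -zeta_nat fmapM compA -zE hE.
rewrite -!compA; congr (_ ∘ _).
rewrite ln !compA -!fmapM; congr (fmap _ _ ∘ _).
by rewrite -compA zeta_nat compA -amapMr mu_unitr amap1 comp1m.
Qed.

Program Definition rep1_of_em1 (V : MonoidalCategory) (X Y : Rep0 V)
    (K : EM1 (em0_of_rep0 X) (em0_of_rep0 Y)) : Rep1 X Y :=
  {| rfun := ebase K; ralpha := lift_nat (elift_fun K) |}.
Next Obligation.
by move=> V X Y K m; apply: (mm_mu (map_of_lift (elift_fun K))).
Qed.
Next Obligation.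
by move=> V X Y K m; apply: (mm_eta (map_of_lift (elift_fun K))).
Qed.
Next Obligation.
by move=> V X Y K c m; apply: lift_nat_law.
Qed.

Program Definition rep2_of_em2 (V : MonoidalCategory) (X Y : Rep0 V)
    (K L : EM1 (em0_of_rep0 X) (em0_of_rep0 Y)) (s : EM2 K L) :
  Rep2 (rep1_of_em1 K) (rep1_of_em1 L) := {| rnat := ebnat s |}.
Next Obligation.
move=> V X Y K L s m.
set F := free_module (rmon X) m.
have := cast_action_map (lift_ob (elift_fun K) F) (lift_ob (elift_fun L) F)
  (elnat_eq s F).
rewrite /= compA => ->; rewrite -!compA; congr (_ ∘ _).
by rewrite -!fmapM (nt_nat (ebnat s)).
Qed.

Program Definition em_to_rep_hom (V : MonoidalCategory) (X Y : Rep0 V) :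
  Functor (EMHom (em0_of_rep0 X) (em0_of_rep0 Y)) (RepHom X Y) :=
  {| fob := @rep1_of_em1 V X Y : EMHom _ _ -> RepHom X Y;
     fmap K L s := rep2_of_em2 s |}.
Next Obligation. by move=> *; apply: rep2_ext. Qed.
Next Obligation. by move=> *; apply: rep2_ext. Qed.

Lemma rep_em_rep (V : MonoidalCategory) (X Y : Rep0 V) :
  fcomp (em_to_rep_hom X Y) (rep_to_em_hom X Y) = fid (RepHom X Y).
Proof.
have E (K : Rep1 X Y) : rep1_of_em1 (em1_of_rep1 K) = K.
  apply: rep1_ext => // m; apply: eq_mor_eq.
  exact: (lift_nat_lift (a := rep1_map K)).
by apply: functor_ext => K L s; apply: rep2_mor_eq; try exact: E.
Qed.

Lemma em_rep_em (V : MonoidalCategory) (X Y : Rep0 V) :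
  fcomp (rep_to_em_hom X Y) (em_to_rep_hom X Y) = fid (EMHom _ _).
Proof.
have E (K : EM1 (em0_of_rep0 X) (em0_of_rep0 Y)) (x : Module (rmon X)) :
    lift_module (rep1_map (rep1_of_em1 K)) x = elift K x.
  exact: (lift_moduleE (E := elift_fun K)).
have E1 (K : EM1 (em0_of_rep0 X) (em0_of_rep0 Y)) :
    em1_of_rep1 (rep1_of_em1 K) = K.
  apply: em1_ext => //; apply: colax_ext => [x y f|c x].
    apply: em_mor_eq; [exact: E | exact: E | ].
    exact: mor_eq_sym (elift_map K f).
  apply: em_mor_eq; [exact: E | | exact: mor_eq_sym (elift_zeta K c x)].
  exact (f_equal (aob (N := EMact (em0_of_rep0 Y)) c) (E K x)).
apply: functor_ext => K L s; apply: em2_mor_eq; try exact: E1.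
  by move=> m; apply: mor_refl.
move=> x; apply: em_mor_eq; [exact: E | exact: E | ].
exact: mor_eq_sym (elnat_eq s x).
Qed.

(** * A criterion for isomorphism of 2-categories *)

Definition cast_hom (A : TwoCategory) (X X' Y Y' : A) (eX : X = X')
    (eY : Y = Y') : Functor (hom2 X Y) (hom2 X' Y') :=
  match eX in _ = X', eY in _ = Y' return Functor (hom2 X Y) (hom2 X' Y') with
  | eq_refl, eq_refl => fid _
  end.

Lemma two_functor_ext (A B : TwoCategory) (F G : TwoFunctor A B)
    (e : forall X, F X = G X) :
  (forall X Y, tf1 G X Y = fcomp (cast_hom (e X) (e Y)) (tf1 F X Y)) -> F = G.
Proof.
case: F G e => [F F1 Fi Fc] [G G1 Gi Gc] /= e.
have E : F = G by apply: functional_extensionality.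
subst G => H.
have E : F1 = G1.
  apply: functional_extensionality_dep => X.
  apply: functional_extensionality_dep => Y.
  rewrite H (proof_irrelevance _ (e X) eq_refl) (proof_irrelevance _ (e Y) eq_refl).
  by apply: functor_ext => x y f; apply: mor_refl.
by subst G1; congr Build_TwoFunctor; apply: proof_irrelevance.
Qed.

(** [G x y] with its source moved from [hom2 (F x) (F y)] to [hom2 X Y]. The
    endpoints [X], [Y] are free variables, so that a statement about it reduces
    to one about [G] by eliminating [eX] and [eY]; this would be impossible with
    [x] and [y] replaced by images of [X] and [Y] under an inverse of [F]. *)
Definition inverse_hom (A B : TwoCategory) (F : TwoFunctor A B)
    (G : forall X Y : A, Functor (hom2 (F X) (F Y)) (hom2 X Y))
    (x y : A) (X Y : B) (eX : F x = X) (eY : F y = Y) :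
  Functor (hom2 X Y) (hom2 x y) :=
  match eX in _ = X, eY in _ = Y return Functor (hom2 X Y) (hom2 x y) with
  | eq_refl, eq_refl => G x y
  end.

Lemma two_isomorphic_of_inverses (A B : TwoCategory) (F : TwoFunctor A B)
    (g : B -> A) (G : forall X Y : A, Functor (hom2 (F X) (F Y)) (hom2 X Y)) :
  (forall X, g (F X) = X) -> (forall Y, F (g Y) = Y) ->
  (forall X Y, fcomp (G X Y) (tf1 F X Y) = fid _) ->
  (forall X Y, fcomp (tf1 F X Y) (G X Y) = fid _) ->
  two_isomorphic A B.
Proof.
move=> gF Fg GF FG.
have Gi X Y (e : F X = Y) : inverse_hom G e e (id2 Y) = id2 X.
  subst Y; rewrite /= -tf_id.
  exact: functor_eq_ob (id2 X) (GF X X).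
have Gc x y z X Y Z (eX : F x = X) (eY : F y = Y) (eZ : F z = Z) :
    fcomp (inverse_hom G eX eZ) (hcomp X Y Z) =
    fcomp (hcomp x y z) (fprod (inverse_hom G eY eZ) (inverse_hom G eX eY)).
  subst X Y Z => /=.
  (* Composition in [B] between objects of the image is conjugate to that of [A]. *)
  have -> : hcomp (F x) (F y) (F z) =
      fcomp (fcomp (tf1 F x z) (hcomp x y z)) (fprod (G y z) (G x y)).
    rewrite tf_comp fcompA.
    have -> : fcomp (fprod (tf1 F y z) (tf1 F x y)) (fprod (G y z) (G x y)) =
        fprod (fcomp (tf1 F y z) (G y z)) (fcomp (tf1 F x y) (G x y)).
      by apply: functor_ext => ? ? ?; apply: mor_refl.
    rewrite !FG; apply: functor_ext => -[? ?] [? ?] [? ?]; exact: mor_refl.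
  rewrite -!fcompA GF; apply: functor_ext => ? ? ?; exact: mor_refl.
pose Ginv := {| tf0 := g; tf1 X Y := inverse_hom G (Fg X) (Fg Y);
  tf_id X := Gi _ _ (Fg X); tf_comp X Y Z := Gc _ _ _ _ _ _ _ _ _ |}.
exists F, Ginv; split.
  apply: (@two_functor_ext _ _ (tfcomp Ginv F) (tfid A) gF) => X Y /=.
  move: (gF X) (gF Y) (Fg (F X)) (Fg (F Y)).
  move: (g (F X)) (g (F Y)) => x y ex ey; subst X Y => ex ey.
  rewrite (proof_irrelevance _ ex eq_refl) (proof_irrelevance _ ey eq_refl) /=.
  by rewrite GF; apply: functor_ext => ? ? ?; apply: mor_refl.
apply: (@two_functor_ext _ _ (tfcomp F Ginv) (tfid B) Fg) => X Y /=.
move: (Fg X) (Fg Y); move: (g X) (g Y) => x y ex ey; subst X Y.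
by rewrite FG; apply: functor_ext => ? ? ?; apply: mor_refl.
Qed.

Theorem mainTheorem5 (V : MonoidalCategory) :
  two_isomorphic (Rep V) (EMLift V).
Proof.
apply: (two_isomorphic_of_inverses (F := rep_to_em V) (g := @rep0_of_em0 V)
  (G := @em_to_rep_hom V)).
- exact: rep0_of_em0_of_rep0.
- exact: em0_of_rep0_of_em0.
- exact: rep_em_rep.
- exact: em_rep_em.
Qed.
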